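(* Let $h>0$ and let $A_h=\frac{1}{h^2}\begin{bmatrix}&-1&\\-1&4&-1\\&-1&\end{bmatrix}$ be the five-point discrete Laplacian on the infinite two-dimensional grid $h\mathbb{Z}^2$. The element-wise additive Vanka operator $M_e$ for $A_h$ is given by the stencil $$M_e=\frac{h^2}{96}\begin{bmatrix}1&4&1\\4&28&4\\1&4&1\end{bmatrix}.$$ Consequently $$M_e=\frac{3}{8}M_{fe}+\frac{h^2}{8}\mathcal{I},$$ where $M_{fe}=\frac{h^2}{36}\begin{bmatrix}1&4&1\\4&16&4\\1&4&1\end{bmatrix}$ is the mass stencil of bilinear finite elements and $\mathcal{I}$ is the identity stencil (centre entry $1$, all other entries $0$).
   Context: Grid functions are functions $u:h\mathbb{Z}^2\to\mathbb{C}$. A stencil $[s_{\boldsymbol k}]_{\boldsymbol k\in\mathbb{Z}^2}$ (finitely many nonzero entries, the centre entry of the displayed array being $\boldsymbol k=0$) defines the operator $(Su)(\boldsymbol x)=\sum_{\boldsymbol k} s_{\boldsymbol k}\,u(\boldsymbol x+h\boldsymbol k)$. Additive Vanka operator: given a family of finite subsets (patches) $\Upsilon_i$ of the grid whose union is the whole grid, let $V_i$ be the restriction of a grid function to $\Upsilon_i$, $V_i^T$ its transpose (extension by zero), and $A_i=V_iA_hV_i^T$. Then $M=\sum_i V_i^T W_i A_i^{-1}V_i$, where $W_i$ is the diagonal matrix whose entry at each grid point of $\Upsilon_i$ is the reciprocal of the number of patches containing that grid point. The element-wise Vanka operator $M_e$ in two dimensions uses as patches the sets of four corners of each grid cell,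 $\{\boldsymbol x,\ \boldsymbol x+(h,0),\ \boldsymbol x+(0,h),\ \boldsymbol x+(h,h)\}$, $\boldsymbol x\in h\mathbb{Z}^2$ (so, in this ordering, $A_i=\frac{1}{h^2}\begin{pmatrix}4&-1&-1&0\\-1&4&0&-1\\-1&0&4&-1\\0&-1&-1&4\end{pmatrix}$ and $W_i=\frac14 I$). *)

(* Defs.v *)
From HB Require Import structures.
From mathcomp Require Import all_boot all_order all_algebra finmap.
From mathcomp Require Import all_classical all_reals.
From mathcomp Require Import complex.

Set Implicit Arguments.
Unset Strict Implicit.
Unset Printing Implicit Defensive.

Import Order.TTheory GRing.Theory Num.Theory.

Local Open Scope classical_set_scope.
Local Open Scope fset_scope.
Local Open Scope ring_scope.
Local Open Scope complex_scope.

Section Vanka.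
Context {F : fieldType} {T I : choiceType}.

(* [patch_lfin] is implicit in the weights, which are reciprocals of the
   number of patches containing a point. *)
Record patch_family := PatchFamily {
  patch :> I -> {fset T};
  patch_cover : forall x, exists i, x \in patch i;
  patch_lfin : forall x, finite_set [set i | x \in patch i] }.

(* A function on a patch [D] is a column vector, via the enumeration of [D]. *)
Definition patch_restr (D : {fset T}) (u : T -> F) : 'cV[F]_#|{: D}| :=
  \col_a u (val (enum_val a)).

Definition patch_ext (D : {fset T}) (v : 'cV[F]_#|{: D}|) (x : T) : F :=
  if insub x is Some y then v (enum_rank (y : D)) 0 else 0.

(* The matrix of [V A V^T], column by column. *)
Definition patch_mx (A : (T -> F) -> (T -> F)) (D : {fset T}) : 'M[F]_#|{: D}| :=
  \matrix_(a, b) patch_restr D (A (patch_ext (delta_mx b 0 : 'cV_#|{: D}|))) a 0.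

Definition patch_count (P : patch_family) (x : T) : nat :=
  #|` fset_set [set i | x \in P i] |%N.

Definition patch_weight (P : patch_family) (i : I) : 'M[F]_#|{: P i}| :=
  diag_mx (\row_a ((patch_count P (val (enum_val a)))%:R)^-1).

(* For given [x] only the finitely many patches containing [x] contribute, so
   the finitely supported sum over all of [I] is the actual sum. The definition
   is meaningful when all the patch matrices are invertible. *)
Definition vanka (A : (T -> F) -> (T -> F)) (P : patch_family)
    (u : T -> F) (x : T) : F :=
  \sum_(i \in [set: I])
    patch_ext (patch_weight P i *m invmx (patch_mx A (P i))
               *m patch_restr (P i) u) x.

End Vanka.
Arguments patch_family : clear implicits.

Section Grid.
Context {R : realType}.
Implicit Type h : R.

Definition in_grid h (x : R * R) : bool :=
  `[< exists k : int * int, x = (h * k.1%:~R, h * k.2%:~R) >].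

Definition grid h := {x : R * R | in_grid h x}.
HB.instance Definition _ h := Choice.on (grid h).

Lemma in_grid_shift h (x : grid h) (k : int * int) :
  in_grid h ((val x).1 + h * k.1%:~R, (val x).2 + h * k.2%:~R).
Proof.
case: x => x /= /asboolP[l ->] /=; apply/asboolP.
by exists (l.1 + k.1, l.2 + k.2); rewrite /= !intrD !mulrDr.
Qed.

(* The grid point [x + h k]. *)
Definition shift h (x : grid h) (k : int * int) : grid h :=
  exist (in_grid h) _ (in_grid_shift x k).

Definition stencil := {fsfun int * int -> R[i] with 0}.

Definition stencil_op h (s : stencil) (u : grid h -> R[i]) (x : grid h) : R[i] :=
  \sum_(k <- finsupp s) s k * u (shift x k).

Definition box3 : {fset int * int} :=
  [fset k in [seq (i, j) | i <- [:: -1; 0; 1 : int], j <- [:: -1; 0; 1 : int]]].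

(* The displayed 3 x 3 array [rows], times the factor [c]. The centre entry is
   [k = 0], columns are ordered by increasing [k.1], and rows from top to bottom
   by decreasing [k.2]. *)
Definition stencil3 (c : R) (rows : seq (seq R)) : stencil :=
  [fsfun k in box3 =>
     (c * (nth [::] rows (absz (1 - k.2 : int)))`_(absz (1 + k.1 : int)))%:C].

Definition laplace5 h : stencil :=
  stencil3 (h ^+ 2)^-1 [:: [::  0; -1;  0];
                           [:: -1;  4; -1];
                           [::  0; -1;  0]].

Definition mass_fe h : stencil :=
  stencil3 (h ^+ 2 / 36) [:: [:: 1;  4; 1];
                             [:: 4; 16; 4];
                             [:: 1;  4; 1]].

Definition stencil_id : stencil :=
  stencil3 1 [:: [:: 0; 0; 0];
                 [:: 0; 1; 0];
                 [:: 0; 0; 0]].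

Definition cell h (x : grid h) : {fset grid h} :=
  [fset x; shift x (1, 0); shift x (0, 1); shift x (1, 1)].

Lemma cell_cover h (x : grid h) : exists y, x \in cell y.
Proof. by exists x; rewrite !inE eqxx. Qed.

Lemma cell_lfin h (x : grid h) : finite_set [set y | x \in cell y].
Proof.
have shiftK (y : grid h) k : shift (shift y k) (- k.1, - k.2) = y.
  by apply: val_inj; case: y => -[y1 y2] /= ?; rewrite !rmorphN !mulrN !addrK.
apply: (@sub_finite_set _ _ [set` [:: x; shift x (-1, -0); shift x (-0, -1);
                                     shift x (-1, -1)]]); last exact: finite_seq.
move=> y /=; rewrite !inE => /orP[/orP[/orP[]|]|] /eqP ->;
  by rewrite ?(shiftK y (1, 0)) ?(shiftK y (0, 1)) ?(shiftK y (1, 1)) eqxx ?orbT.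
Qed.

(* The cells are indexed by their lower left corner. *)
Definition cells h : patch_family (grid h) (grid h) :=
  PatchFamily (@cell_cover h) (@cell_lfin h).

Definition vanka_elem h : (grid h -> R[i]) -> grid h -> R[i] :=
  vanka (stencil_op (laplace5 h)) (cells h).

End Grid.

(* Main.v *)
Require Import Defs.
From mathcomp Require Import all_boot all_order all_algebra finmap.
From mathcomp Require Import all_classical all_reals.
From mathcomp Require Import complex.
From mathcomp Require Import ring.

(* On a cell, the equation A v = u with v supported in the cell has an explicit
   solution: the cell matrix has inverse [h^2/24] times the symmetric matrix with
   entries 7, 2, 1 according to the relative position of two corners. Every point
   lies in four cells, once in each corner position, so averaging the four local
   solutions gives the stencil: centre [4 * 7 / 96], edge neighbours
   [2 * 2 / 96] (two common cells), diagonal neighbours [1 / 96]. *)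

Import Order.TTheory GRing.Theory Num.Theory.
Local Open Scope ring_scope.
Local Open Scope complex_scope.

(** * Local problems on an arbitrary patch *)

Section LocalSolve.
Context {F : fieldType} {T I : choiceType}.
Implicit Types (D : {fset T}) (u v : T -> F).

(** Linearity in the shape of the expansion of a column vector over the unit columns that define
    [patch_mx]. *)
Definition preserves_lincomb (A : (T -> F) -> T -> F) :=
  forall n (c : 'I_n -> F) (f : 'I_n -> T -> F) x,
    A (fun y => \sum_j c j * f j y) x = \sum_j c j * A (f j) x.

Lemma patch_ext_notin D (w : 'cV[F]_#|{: D}|) x : x \notin D -> patch_ext w x = 0.
Proof. by move=> xD; rewrite /patch_ext insubN. Qed.

Lemma patch_ext_restr D v : (forall x, x \notin D -> v x = 0) ->
  patch_ext (patch_restr D v) = v.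
Proof.
move=> vD; apply/funext => x; rewrite /patch_ext.
case: insubP => [y yD <-|/vD->//].
by rewrite mxE enum_rankK.
Qed.

Lemma patch_restrP D u v : {in D, u =1 v} -> patch_restr D u = patch_restr D v.
Proof. by move=> uv; apply/colP => a; rewrite !mxE uv// fsvalP. Qed.

Lemma patch_ext_lincomb D (w : 'cV[F]_#|{: D}|) :
  patch_ext w = fun x => \sum_j w j 0 * patch_ext (delta_mx j 0 : 'cV_#|{: D}|) x.
Proof.
apply/funext => x; rewrite /patch_ext; case: insubP => [y _ _|_].
  rewrite (bigD1 (enum_rank y))//= mxE !eqxx mulr1 big1 ?addr0// => j jy.
  by rewrite mxE eq_sym (negPf jy) mulr0.
by rewrite big1// => j _; rewrite mulr0.
Qed.

Lemma patch_mx_mul {A : (T -> F) -> T -> F} D (w : 'cV[F]_#|{: D}|) :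
  preserves_lincomb A -> patch_mx A D *m w = patch_restr D (A (patch_ext w)).
Proof.
move=> Alin; apply/colP => a; rewrite !mxE [in RHS]patch_ext_lincomb Alin.
by apply: eq_bigr => b _; rewrite !mxE mulrC.
Qed.

Section Solution.
(** [G] models the local solve on [D], extended by zero. *)
Variables (A : (T -> F) -> T -> F) (D : {fset T}) (G : (T -> F) -> T -> F).
Hypothesis Alin : preserves_lincomb A.
Hypothesis G_supp : forall u x, x \notin D -> G u x = 0.
Hypothesis G_solve : forall u, {in D, A (G u) =1 u}.

Lemma patch_mx_solve u : patch_mx A D *m patch_restr D (G u) = patch_restr D u.
Proof.
by rewrite patch_mx_mul// patch_ext_restr; [exact: patch_restrP|exact: G_supp].
Qed.

(** The solutions for the unit columns form a right inverse [B], and a square matrix with a right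
    inverse is invertible. *)
Lemma patch_mx_unit : patch_mx A D \in unitmx.
Proof.
pose B := \matrix_(i, j) patch_restr D
  (G (patch_ext (delta_mx j 0 : 'cV[F]_#|{: D}|))) i 0.
suff /mulmx1_unit[] : patch_mx A D *m B = 1%:M by [].
apply/matrixP => i j; set e : 'cV[F]_#|{: D}| := delta_mx j 0.
transitivity ((patch_mx A D *m patch_restr D (G (patch_ext e))) i 0).
  by rewrite !mxE; apply: eq_bigr => k _; rewrite !mxE.
rewrite patch_mx_solve !mxE /patch_ext insubT ?fsvalP// => yD.
rewrite /e mxE eqxx andbT; congr ((_ == _)%:R).
by rewrite -[RHS]enum_valK; congr enum_rank; apply: val_inj.
Qed.

Lemma invmx_patch_restr u :
  invmx (patch_mx A D) *m patch_restr D u = patch_restr D (G u).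
Proof. by rewrite -patch_mx_solve mulmxA mulVmx ?mul1mx// patch_mx_unit. Qed.

End Solution.

(** Solvability on each patch makes every [invmx] a true inverse, and the weight at [x] is the same
    in all patches containing [x]. *)
Lemma vankaE {A : (T -> F) -> T -> F} {P : patch_family T I}
    {G : I -> (T -> F) -> T -> F} :
  preserves_lincomb A ->
  (forall i u x, x \notin P i -> G i u x = 0) ->
  (forall i u, {in P i, A (G i u) =1 u}) ->
  forall u x, vanka A P u x =
    \sum_(i \in [set: I]) (patch_count P x)%:R^-1 * G i u x.
Proof.
move=> Alin Gsupp Gsolve u x; apply: eq_fsbigr => i _.
rewrite -mulmxA (invmx_patch_restr _ _ _ Alin (Gsupp i) (Gsolve i)).
(* [v] vanishes off the patch, so it is the zero extension of its own restriction. *)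
pose v z := (patch_count P z)%:R^-1 * G i u z.
rewrite -[RHS]/(v x) -(patch_ext_restr (P i) v) => [|z zP]; last first.
  by rewrite /v Gsupp ?mulr0.
congr (patch_ext _ _); apply/colP => a.
by rewrite mul_diag_mx !mxE.
Qed.

End LocalSolve.

(** * Stencils and cells on the grid *)

Section Stencils.
Context {R : realType} {h : R}.
Implicit Types (x y z : grid h) (u v : grid h -> R[i]).

Lemma shift0 x : shift x (0, 0) = x.
Proof. by apply: val_inj; case: x => -[a b] ? /=; rewrite !mulr0 !addr0. Qed.

Lemma shiftD x k l : shift (shift x k) l = shift x (k.1 + l.1, k.2 + l.2).
Proof. by apply: val_inj; rewrite /= !intrD !mulrDr !addrA. Qed.

Lemma eq_shift x k l : h != 0 -> (shift x k == shift x l) = (k == l).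
Proof.
move=> h0; rewrite -val_eqE; case: k l => [a b] [c d]; rewrite /= !xpair_eqE.
by rewrite !(inj_eq (addrI _)) !(inj_eq (mulfI h0)) !eqr_int.
Qed.

Lemma stencil_op_lincomb (s : stencil) : preserves_lincomb (@stencil_op R h s).
Proof.
move=> n c f x; rewrite /stencil_op.
under eq_bigr do rewrite mulr_sumr.
rewrite exchange_big; apply: eq_bigr => j _ /=; rewrite mulr_sumr.
by apply: eq_bigr => k _; rewrite mulrCA.
Qed.

Lemma stencil_op3E (c : R) rows u x :
  stencil_op (stencil3 c rows) u x =
  \sum_(k <- ([seq (i, j) | i <- [:: -1; 0; 1], j <- [:: -1; 0; 1]] : seq (int * int)))
    (c * (nth [::] rows (absz (1 - k.2 : int)))`_(absz (1 + k.1 : int)))%:C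
    * u (shift x k).
Proof.
(* The support may be smaller than the box, since displayed entries can be zero; the added terms
   vanish. *)
rewrite /stencil_op (@big_fset_incl _ _ _ _ _ box3); first last.
- by move=> k _ ks; rewrite fsfun_dflt// mul0r.
- by apply/fsubsetP => k; apply: contraLR => kb; rewrite memNfinsupp fsfunE (negPf kb).
set r := (X in _ = \sum_(k <- X) _).
have box3_r : perm_eq (enum_fset box3) r.
  by apply: uniq_perm; rewrite ?fset_uniq// => k; rewrite /box3 in_fset.
rewrite -(perm_big _ box3_r); apply: eq_big_seq => k kb.
by rewrite fsfunE kb.
Qed.

Definition corners : seq (int * int) := [:: (0, 0); (1, 0); (0, 1); (1, 1)].

Lemma in_cell x y : (x \in cell y) = has (fun k => x == shift y k) corners.
Proof. by rewrite !inE /= shift0 orbF !orbA. Qed.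

(* [h ^+ 2 / 24] times these weights is the inverse of the matrix of the Laplacian
   on a cell. *)
Definition corner_weight (k l : int * int) : R[i] :=
  if k == l then 7 else if (k.1 == l.1) || (k.2 == l.2) then 2 else 1.

(** The indicators make this a function on the whole grid, zero off the cell; for [h != 0] the
    corners are distinct, so one term survives at each corner. *)
Definition cell_solve y u x : R[i] :=
  \sum_(k <- corners) (x == shift y k)%:R *
    (h%:C ^+ 2 / 24 * \sum_(l <- corners) corner_weight k l * u (shift y l)).

Lemma cell_solve_notin y u x : x \notin cell y -> cell_solve y u x = 0.
Proof.
rewrite in_cell => /hasPn xy; rewrite /cell_solve big_seq big1// => k kc.
by rewrite (negPf (xy k kc)) mul0r.
Qed.

Lemma cell_solve_shift y u k : h != 0 -> cell_solve y u (shift y k) =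
  if k \in corners then
    h%:C ^+ 2 / 24 * \sum_(l <- corners) corner_weight k l * u (shift y l)
  else 0.
Proof.
move=> h0; rewrite /cell_solve.
under eq_bigr do rewrite eq_shift//.
case: ifP => kc; last first.
  rewrite big_seq big1// => l lc; case: eqP => [kl|_]; last by rewrite mul0r.
  by rewrite -kl kc in lc.
rewrite (bigD1_seq k)//= eqxx mul1r [X in _ + X]big1 ?addr0// => l /negPf lk.
by rewrite eq_sym lk mul0r.
Qed.

(** A corner has two neighbours inside the cell, and the solve is zero at the other two. The weights
    then satisfy 4*7 - 2 - 2 = 24, 4*2 - 7 - 1 = 0 and 4*1 - 2 - 2 = 0. *)
Lemma laplace5_cell_solve y u : h != 0 ->
  {in cell y, stencil_op (laplace5 h) (cell_solve y u) =1 u}.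
Proof.
move=> h0 x; rewrite in_cell => /hasP[k kc /eqP->{x}].
have H0 : h%:C != 0 by rewrite eq_complex /= eqxx andbT.
rewrite stencil_op3E /= !big_cons big_nil /=.
rewrite !shiftD !cell_solve_shift//.
move: kc; rewrite !inE => /or4P[] /eqP-> /=.
all: rewrite /corners !unlock /= /corner_weight /=.
all: rewrite ?(rmorphM, fmorphV, rmorphXn, rmorphN, rmorph0, rmorph1, rmorph_nat)/=.
all: field.
all: exact: H0.
Qed.

(** The index of the cell in which [x] is the corner at position [k]. *)
Definition back x (k : int * int) : grid h := shift x (- k.1, - k.2).

Lemma back_shift x y k : (x == shift y k) = (y == back x k).
Proof.
apply/eqP/eqP => ->; rewrite /back shiftD/= ?subrr ?addNr;
  by rewrite ?(addrN, addNr) shift0.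
Qed.

Lemma mem_cell x y : (x \in cell y) = (y \in [seq back x k | k <- corners]).
Proof.
rewrite in_cell; apply/hasP/mapP => -[k kc xy]; exists k => //.
  by apply/eqP; rewrite -back_shift.
by rewrite back_shift; apply/eqP.
Qed.

Lemma uniq_back x : h != 0 -> uniq [seq back x k | k <- corners].
Proof.
move=> h0; rewrite map_inj_uniq// => -[a b] [c d] /eqP; rewrite eq_shift//=.
by rewrite xpair_eqE !eqr_opp => /andP[/eqP-> /eqP->].
Qed.

Lemma patch_count_cells x : h != 0 -> patch_count (cells h) x = 4.
Proof.
move=> h0; rewrite /patch_count.
have -> : [set y | x \in cells h y]%classic =
          [set` [fset y in [seq back x k | k <- corners]]%fset]%classic.
  by apply/seteqP; split => y /=; rewrite mem_cell in_fset.
by rewrite set_fsetK card_fseq undup_id ?uniq_back.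
Qed.

Lemma vanka_elemE u x : h != 0 ->
  vanka_elem u x = \sum_(k <- corners) 4^-1 * cell_solve (back x k) u x.
Proof.
move=> h0; rewrite /vanka_elem.
rewrite (vankaE (G := cell_solve) (stencil_op_lincomb _)); last 2 first.
- by move=> y v z; exact: cell_solve_notin.
- by move=> y v; exact: laplace5_cell_solve.
rewrite patch_count_cells// -(big_map (back x) xpredT (fun y => 4^-1 * cell_solve y u x)).
(* Only the four cells containing [x] contribute to the sum over all cells. *)
rewrite (fsbigTE [fset y in [seq back x k | k <- corners]]%fset) => [|y].
  apply/esym/perm_big/uniq_perm; rewrite ?fset_uniq ?uniq_back// => y.
  by rewrite in_fset.
by rewrite in_fset -mem_cell => /cell_solve_notin->; rewrite mulr0.
Qed.

Lemma vanka_elem_stencil u x : h != 0 ->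
  vanka_elem u x = stencil_op (stencil3 (h ^+ 2 / 96) [:: [:: 1;  4; 1];
                                                         [:: 4; 28; 4];
                                                         [:: 1;  4; 1]]) u x.
Proof.
move=> h0; rewrite vanka_elemE// stencil_op3E /= !big_cons !big_nil.
(* Writing the evaluation point as a corner of its cell brings it into the form handled by
   [cell_solve_shift]. *)
have cell_solve_back k : cell_solve (back x k) u x =
    cell_solve (back x k) u (shift (back x k) k).
  by congr cell_solve; apply/eqP; rewrite back_shift.
rewrite !cell_solve_back !cell_solve_shift//= !unlock /= /corner_weight /=.
rewrite /back !shiftD /=.
rewrite ?(rmorphM, fmorphV, rmorphXn, rmorphN, rmorph0, rmorph1, rmorph_nat)/=.
by field.
Qed.

(** Since 3/8 * 1/36 = 1/96, the arrays agree off the centre, where 16/96 + 1/8 = 28/96. *)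
Lemma stencil3_mass_id (u : grid h -> R[i]) x :
  stencil_op (stencil3 (h ^+ 2 / 96) [:: [:: 1;  4; 1];
                                        [:: 4; 28; 4];
                                        [:: 1;  4; 1]]) u x =
  (3 / 8) * stencil_op (mass_fe h) u x
  + (h ^+ 2 / 8)%:C * stencil_op stencil_id u x.
Proof.
rewrite !stencil_op3E /= !big_cons !big_nil /=.
rewrite ?(rmorphM, fmorphV, rmorphXn, rmorphN, rmorph0, rmorph1, rmorph_nat)/=.
by field.
Qed.

End Stencils.

Theorem mainTheorem8 (R : realType) (h : R) (h_gt0 : 0 < h) :
  (forall (u : grid h -> R[i]) (x : grid h),
     vanka_elem u x =
     stencil_op (stencil3 (h ^+ 2 / 96) [:: [:: 1;  4; 1];
                                            [:: 4; 28; 4];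
                                            [:: 1;  4; 1]]) u x)
  /\
  (forall (u : grid h -> R[i]) (x : grid h),
     vanka_elem u x =
     (3 / 8) * stencil_op (mass_fe h) u x
     + (h ^+ 2 / 8)%:C * stencil_op stencil_id u x).
Proof.
have h0 : h != 0 by rewrite gt_eqF.
split=> u x; first exact: vanka_elem_stencil.
by rewrite vanka_elem_stencil// stencil3_mass_id.
Qed.
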